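(* (i) If a Lie algebra $\mathcal{L}\in\mathbf{Sem}(P_{\mathfrak{S}^{\max}})$ is solvable, then $\mathcal{L}_{[2]}=\{0\}$. (ii) Let $\mathcal{L}\in\mathbf{Sem}(P_{\mathfrak{S}^{\max}})$. Then $\mathcal{L}$ is nilpotent if and only if $\mathcal{L}$ is commutative. (iii) Any solvable Lie algebra in $\mathbf{Sem}(P_{\mathfrak{J}^{\max}})$ is commutative.
   Context: A Banach Lie algebra is a complex Lie algebra $\mathcal{L}$ which is a Banach space in a norm such that, for some $t_{\mathcal{L}}>0$, $\|[a,b]\|\leq t_{\mathcal{L}}\|a\|\|b\|$ for all $a,b\in\mathcal{L}$. $\mathbf{Sem}(P_{\mathfrak{S}^{\max}})$ (the Frattini-free Banach Lie algebras) is the class of Banach Lie algebras $\mathcal{L}$ such that the intersection of all maximal proper closed Lie subalgebras of finite codimension in $\mathcal{L}$ is $\{0\}$. $\mathbf{Sem}(P_{\mathfrak{J}^{\max}})$ is the class of Banach Lie algebras $\mathcal{L}$ such that the intersection of all maximal proper closed Lie ideals of finite codimension in $\mathcal{L}$ is $\{0\}$. (An intersection over the empty family is $\mathcal{L}$.) Put $\mathcal{L}^{[1]}=\mathcal{L}_{[0]}=\mathcal{L}$, $\mathcal{L}^{[n+1]}=\overline{[\mathcal{L},\mathcal{L}^{[n]}]}$ and $\mathcal{L}_{[n+1]}=\overline{[\mathcal{L}_{[n]},\mathcal{L}_{[n]}]}$ (closed linear spans of brackets). $\mathcal{L}$ is nilpotent if $\mathcal{L}^{[n]}=\{0\}$ for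 some $n$, and solvable if $\mathcal{L}_{[n]}=\{0\}$ for some $n$. *)

(* Defs.v *)
From HB Require Import structures.
From mathcomp Require Import all_boot all_order all_algebra.
From mathcomp Require Export complex.
From mathcomp Require Import all_classical all_reals all_analysis.

Set Implicit Arguments.
Unset Strict Implicit.
Unset Printing Implicit Defensive.

Import Order.TTheory GRing.Theory Num.Theory.
Import numFieldNormedType.Exports.

Local Open Scope classical_set_scope.
Local Open Scope ring_scope.

(* The norm of a normedModType K is K-valued. For K = R[i], 0 < t forces t to
   be real, so lieb_bounded is the usual real inequality. *)
HB.mixin Record isBanachLie (K : numFieldType) L of CompleteNormedModule K L := {
  lieb : L -> L -> L ;
  lieb_linearl : forall b : L, linear (fun a : L => lieb a b) ;
  lieb_linearr : forall a : L, linear (lieb a) ;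
  liebxx : forall a : L, lieb a a = 0 ;
  lieb_jacobi : forall a b c : L,
    lieb a (lieb b c) + lieb b (lieb c a) + lieb c (lieb a b) = 0 ;
  lieb_bounded : exists2 t : K, 0 < t &
    forall a b : L, `|lieb a b| <= t * `|a| * `|b| }.

#[short(type="banachLieType")]
HB.structure Definition BanachLie (K : numFieldType) :=
  {L of CompleteNormedModule K L & isBanachLie K L}.

Section BanachLieDefs.
Context {K : numFieldType} {L : banachLieType K}.
Implicit Types (A B M : set L) (F : set (set L)).

Definition linear_subspace M := submod_closed (mem M).

Definition lie_subalgebra M :=
  linear_subspace M /\ forall a b, M a -> M b -> M (lieb a b).

Definition lie_ideal M :=
  linear_subspace M /\ forall a b, M b -> M (lieb a b).

(* The cosets of the e i span L / M. *)
Definition finite_codim M := exists (n : nat) (e : 'I_n -> L),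
  forall x, exists c : 'I_n -> K, M (x - \sum_(i < n) c i *: e i).

Definition proper_closed F : set (set L) :=
  [set M | [/\ F M, closed M & M != setT]].

Definition maximal_in F : set (set L) :=
  [set M | F M /\ forall N, F N -> M `<=` N -> N = M].

(* Maximality is among all proper closed members of F. It would be the same
   among those of finite codimension, as that property passes to supersets. *)
Definition max_closed_finite_codim F : set (set L) :=
  maximal_in (proper_closed F) `&` finite_codim.

Definition closed_span A := closure (smallest linear_subspace A).

Definition closed_bracket A B :=
  closed_span [set lieb a b | a in A & b in B].

End BanachLieDefs.

Section BanachLieClasses.
Context {K : numFieldType} (L : banachLieType K).

(* Sem(P_{S^max}); \bigcap over an empty family is setT. *)
Definition Sem_Smax : Prop :=
  \bigcap_(M in max_closed_finite_codim (@lie_subalgebra K L)) M = [set 0].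

(* Sem(P_{J^max}) *)
Definition Sem_Jmax : Prop :=
  \bigcap_(M in max_closed_finite_codim (@lie_ideal K L)) M = [set 0].

(* lower_central n is L^{[n+1]}: the classical numbering starts at 1. *)
Fixpoint lower_central (n : nat) : set L :=
  if n is m.+1 then closed_bracket setT (lower_central m) else setT.

(* derived_lie n is L_{[n]}. *)
Fixpoint derived_lie (n : nat) : set L :=
  if n is m.+1 then closed_bracket (derived_lie m) (derived_lie m) else setT.

Definition nilpotent_lie : Prop := exists n, lower_central n = [set 0].

Definition solvable_lie : Prop := exists n, derived_lie n = [set 0].

Definition commutative_lie : Prop := forall a b : L, lieb a b = 0.

End BanachLieClasses.

Arguments lower_central {K} L n.
Arguments derived_lie {K} L n.

(* Main.v *)
(** Let M be a maximal closed subalgebra (or ideal) and let S_k be the derived or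
    lower central series, whose terms are closed ideals. If k is the last index
    with S_k not inside M, then M + S_k is dense by maximality, while the brackets
    of S_k with itself (with L, in the nilpotent case) fall into M; in (ii) and
    (iii) this puts [L, L] into M.

    For (i), Lie's theorem for the action of M on the finite-dimensional space
    L / M gives v outside M with [a, v] in K v + M for all a in M. As M + K v is a
    dense subalgebra, every a in M acts on L / M as a scalar. If k >= 2, take v
    in S_k instead: S_1 then maps v into M, and approximating x in S_(k-1) by
    elements of M + K v gives [x, y] in M for x, y in S_(k-1), so S_k lies in M,
    a contradiction. Hence S_2 lies in M. *)
Require Import Defs.
From HB Require Import structures.
From mathcomp Require Import all_boot all_order all_algebra spectral ring.
From mathcomp Require Import all_classical all_reals all_analysis.
From mathcomp Require Import complex.
Set Implicit Arguments.
Unset Strict Implicit.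
Unset Printing Implicit Defensive.
Import Order.TTheory GRing.Theory Num.Theory.
Import numFieldNormedType.Exports.
Local Open Scope classical_set_scope.
Local Open Scope ring_scope.

(** * Lie's theorem *)

Section WeightCommutator.
Variables (K : numFieldType) (m : nat) (T : set 'M[K]_m.+1) (y : 'M[K]_m.+1).
Variables (v : 'rV[K]_m.+1) (lam : 'M[K]_m.+1 -> K).
Hypothesis v_lam : forall s, T s -> v *m s = lam s *: v.
Hypothesis T_y : forall s, T s -> T (y * s - s * y).

(* Moving [s] through [q(y)] gives the Taylor expansion with coefficients the
   weights of the iterated commutators; only its first two terms matter. *)
Lemma weight_horner (q : {poly K}) (s : 'M[K]_m.+1) : T s ->
  exists2 r : {poly K}, (size r <= (size q).-2)%N &
    v *m horner_mx y q *m s =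
    v *m horner_mx y (lam s *: q + lam (y * s - s * y) *: q^`() + r).
Proof.
elim/poly_ind: q s => [|q c IH] s Ts.
  by exists 0; rewrite ?size_poly0 // deriv0 !scaler0 !addr0 rmorph0 mulmx0 mul0mx.
have [r ler er] := IH _ Ts; have [r1 ler1 er1] := IH _ (T_y Ts).
set s1 := y * s - s * y in r1 ler1 er1 *; set s2 := y * s1 - s1 * y in r1 ler1 er1 *.
(* Multiplying the expansion for [s] by ['X] and adding the one for [s1] produces [lam s] and
   [lam s1] times the first two Taylor terms of [q * 'X + c]; this is what is left over. *)
exists (r * 'X + lam s2 *: q^`() + r1).
  have [q0|q0] := eqVneq q 0.
    move: ler ler1; rewrite q0 size_poly0 /= !leqn0 !size_poly_eq0.
    by move=> /eqP-> /eqP->; rewrite deriv0 scaler0 mul0r !addr0 size_poly0.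
  have sq : (0 < size q)%N by rewrite size_poly_gt0.
  rewrite size_MXaddC (negPf q0) /=.
  rewrite (leq_trans (size_polyD _ _)) // geq_max; apply/andP; split; last first.
    by rewrite (leq_trans ler1) // leq_pred.
  rewrite (leq_trans (size_polyD _ _)) // geq_max; apply/andP; split; last first.
    by rewrite (leq_trans (size_scale_leq _ _)) // -ltnS prednK // lt_size_deriv.
  have [->|r0] := eqVneq r 0; first by rewrite mul0r size_poly0.
  rewrite size_mulX //; have := ler; have : (0 < size r)%N by rewrite size_poly_gt0.
  by case: (size q) => [|[]] //=; case: (size r).
(* The new factor [y] is moved past [s] by [y * s = s * y + s1]. *)
have -> : v *m horner_mx y (q * 'X + c%:P) *m s =
    v *m horner_mx y q *m s *m y + v *m horner_mx y q *m s1 + c *: (v *m s).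
  rewrite rmorphD rmorphM /= horner_mx_X horner_mx_C mulmxDr mulmxDl.
  rewrite mul_mx_scalar -scalemxAl; congr (_ + _).
  rewrite -![in LHS]mulmxA -![in RHS]mulmxA -mulmxDr -mulmxDr /s1.
  by rewrite -mulmxE addrC subrK.
rewrite er er1 (v_lam Ts) scalerA derivMXaddC -mulmxA -/s1 -/s2.
have -> : horner_mx y (lam s *: q + lam s1 *: q^`() + r) *m y =
  horner_mx y ((lam s *: q + lam s1 *: q^`() + r) * 'X).
  by rewrite rmorphM /= horner_mx_X.
have -> : (c * lam s) *: v = v *m horner_mx y (c * lam s)%:P.
  by rewrite horner_mx_C mul_mx_scalar.
rewrite -!mulmxDr -!rmorphD /=; congr (v *m horner_mx y _).
rewrite -!mul_polyC polyCM; ring.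
Qed.

(* If [p] has least degree among the polynomials with [v p(y) = 0], the Taylor
   expansion gives one of smaller degree, with leading coefficient
   [deg p * lead_coef p * lam [y, s]]; this replaces the usual trace argument. *)
Lemma weight_commutator (s : 'M[K]_m.+1) : v != 0 -> T s ->
  lam (y * s - s * y) = 0.
Proof.
move=> v0 Ts.
pose P n := `[< exists2 p : {poly K}, size p = n & p != 0 /\ v *m horner_mx y p = 0 >].
have exP : exists n, P n.
  exists (size (char_poly y)); apply/asboolP; exists (char_poly y) => //.
  by rewrite Cayley_Hamilton mulmx0 monic_neq0 // char_poly_monic.
case: (ex_minnP exP) => n /asboolP[p sp [p0 vp]] minn.
have [r ler] := weight_horner p Ts.
rewrite vp mul0mx => /esym/eqP.
rewrite -addrA rmorphD mulmxDr /= linearZ /= -scalemxAr vp scaler0 add0r => /eqP vq.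
set q := _ + r in vq.
have sp1 : (1 < size p)%N.
  rewrite ltnNge; apply/negP => sp1.
  move: p0 vp; rewrite (size1_polyC sp1) polyC_eq0 horner_mx_C mul_mx_scalar.
  by move=> p0 /eqP; rewrite scaler_eq0 (negPf p0) (negPf v0).
have sq : (size q < size p)%N.
  rewrite (leq_ltn_trans (size_polyD _ _)) // gtn_max; apply/andP; split.
    by rewrite (leq_ltn_trans (size_scale_leq _ _)) // lt_size_deriv.
  by rewrite (leq_ltn_trans ler) //; case: (size p) sp1 => [|[]].
have q0 : q = 0.
  apply: contraTeq sq => q0; rewrite -leqNgt sp; apply: minn.
  by apply/asboolP; exists q.
(* The index [(size p).-2] is the degree of the derivative of [p] and lies beyond the size bound on
   [r], so only the weight term contributes; characteristic zero keeps [deg p] invertible. *)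
have /eqP : q`_(size p).-2 = 0 by rewrite q0 coef0.
rewrite coefD coefZ coef_deriv [r`_ _]nth_default // addr0.
have -> : (size p).-2.+1 = (size p).-1 by case: (size p) sp1 => [|[]].
rewrite -lead_coefE mulf_eq0 mulrn_eq0 lead_coef_eq0 (negPf p0) orbF.
by case: (size p) sp1 => [|[]] //= k _; rewrite orbF => /eqP.
Qed.

End WeightCommutator.

(** In a basis of [U] the restriction of [x] is a square matrix of positive size, which has an
    eigenvalue over a closed field; its eigenvector is carried back by [row_base U]. *)
Lemma stable_eigenvector (K : numClosedFieldType) m (U x : 'M[K]_m) :
  U != 0 -> stablemx U x ->
  exists a, exists2 v : 'rV_m, (v <= U)%MS & v != 0 /\ v *m x = a *: v.
Proof.
move=> U0 Ux; have rU : (0 < \rank U)%N by rewrite lt0n mxrank_eq0.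
have [a] := eigenvalue_closed (conjmx (row_base U) x) rU.

move=> /eigenvalueP[w wa w0]; exists a; exists (w *m row_base U).
  by rewrite mulmx_sub // eq_row_base.
split; first by rewrite mulmx_free_eq0 ?row_base_free.
apply/eigenspaceP; rewrite -sub_eigenspace_conjmx ?row_base_free ?stablemx_row_base //.
exact/eigenspaceP.
Qed.

(* Induction on the length of the filtration. The weight space of a common
   eigenvector of [D 1] is stable under [D 0], and any nonzero subspace of it
   that is minimal among the stable ones consists of common eigenvectors. *)
Theorem lie_theorem (K : numClosedFieldType) m n (D : nat -> set 'M[K]_m.+1) :
  (forall i x y, D i x -> D i y -> D i.+1 (x * y - y * x)) ->
  (forall i, D i.+1 `<=` D i) -> D n `<=` [set 0] ->
  exists2 v : 'rV[K]_m.+1, v != 0 &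
    forall x, D 0 x -> exists a, v *m x = a *: v.
Proof.
elim: n D => [|n IH] D Dcomm Ddec D0.
  exists (const_mx 1) => [|x /D0->]; last by exists 0; rewrite mulmx0 scale0r.
  by apply/eqP => /rowP/(_ ord0)/eqP; rewrite !mxE oner_eq0.
have [||//|v v0 vD] := IH (D \o S); first by move=> *; exact: Dcomm.
  by move=> i; exact: Ddec.
have [lam vlam] : {lam & forall s, D 1 s -> v *m s = lam s *: v}.
  apply: (@choice _ _ (fun s a => D 1 s -> v *m s = a *: v)) => s.
  by have [/vD[a va]|//] := pselect (D 1 s); [exists a|exists 0].
pose wt (u : 'rV_m.+1) := forall s, D 1 s -> u *m s = lam s *: u.
have D1c x s : D 0 x -> D 0 s -> D 1 (x * s - s * x) by exact: Dcomm.
have lam_comm x s : D 0 x -> D 1 s -> lam (x * s - s * x) = 0.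
  move=> D0x D1s; apply: (weight_commutator vlam) => // t D1t.
  by apply: D1c => //; exact: Ddec.
(* [D 1] may be infinite, so its weight space is obtained as the row space of a matrix of maximal
   rank among those whose row space consists of weight vectors. *)
pose P k := `[< exists2 U : 'M[K]_m.+1, \rank U = k &
                  forall u : 'rV_m.+1, (u <= U)%MS -> wt u >].
have exP : exists k, P k.
  exists (\rank <<v>>%MS); apply/asboolP; exists <<v>>%MS => // u.
  by rewrite genmxE => /sub_rVP[c ->] s D1s; rewrite -scalemxAl vlam // !scalerA mulrC.
have ubP k : P k -> (k <= m.+1)%N.
  by move=> /asboolP[U <- _]; exact: rank_leq_row.
case: (ex_maxnP exP ubP) => k /asboolP[U rU wtU] maxU.
have sub_U (u : 'rV_m.+1) : wt u -> (u <= U)%MS.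
  move=> wtu; suff /eqmxP/addsmx_idPl : (U + u == U)%MS by [].
  rewrite andbC -(mxrank_leqif_eq (addsmxSl U u)) eqn_leq mxrankS ?addsmxSl //= rU.
  apply: maxU; apply/asboolP; exists (U + u)%MS => // w /sub_addsmxP[[a b] /= ->].
  move=> s D1s; rewrite mulmxDl scalerDr wtU ?submxMl // -!mulmxA wtu //.
  by rewrite -scalemxAr.
have U0 : U != 0.
  by apply: contraNneq v0 => U0; move: (sub_U v vlam); rewrite U0 submx0.
(* The commutator of [x] and [s] has weight 0, hence [w x s = w s x = lam s *: w x] for [w] in
   [U]. *)
have Ux x : D 0 x -> stablemx U x.
  move=> D0x; apply/rV_subP => _ /submxP[w ->]; rewrite mulmxA; apply: sub_U => s D1s.
  have wU := wtU _ (submxMl w U); have := wU _ (D1c _ _ D0x (Ddec _ _ D1s)).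
  rewrite lam_comm // scale0r mulmxBr => /subr0_eq.
  by rewrite -!mulmxE !mulmxA => ->; rewrite wU // -scalemxAl.
pose Q k := `[< exists2 Z : 'M[K]_m.+1, \rank Z = k &
    [/\ Z != 0, (Z <= U)%MS & forall x, D 0 x -> stablemx Z x] >].
have exQ : exists k, Q k by exists (\rank U); apply/asboolP; exists U.
case: (ex_minnP exQ) => l /asboolP[Z rZ [Z0 ZU Zx]] minZ.
exists (nz_row Z); first by rewrite nz_row_eq0.
move=> x D0x; have [a [w wZ [w0 wx]]] := stable_eigenvector Z0 (Zx x D0x).
exists a; apply/eigenspaceP; apply: submx_trans (nz_row_sub _) _.
(* The commutator acts on [Z] by one scalar, so it can be computed at [w]. There [D 1] is enlarged
   by [x] with weight [a], and [weight_commutator] makes the scalar vanish. Comparing both weights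
   at [w] also covers the case where the commutator equals [x]. *)
have Zcomm y (z : 'rV_m.+1) : D 0 y -> (z <= Z)%MS -> z *m (y * x - x * y) = 0.
  move=> D0y zZ; have D1yx := D1c _ _ D0y D0x.
  rewrite (wtU z) ?(submx_trans zZ) //.
  pose T := [set s | s = x \/ D 1 s]; pose mu s := if s == x then a else lam s.
  have wT s : T s -> w *m s = mu s *: w.
    rewrite /mu; case: eqVneq => [->//|sx [/eqP|D1s]]; first by rewrite (negPf sx).
    by apply: wtU => //; exact: submx_trans ZU.
  have Ty s : T s -> T (y * s - s * y).
    by case=> [->|D1s]; right; apply: D1c => //; exact: Ddec.
  have /eqP := wT _ (or_intror D1yx : T _).
  rewrite (weight_commutator wT Ty) //; last by left.
  rewrite (wtU w) ?(submx_trans wZ) // scale0r scaler_eq0 (negPf w0) orbF => /eqP->.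
  by rewrite scale0r.
(* Since [x] commutes with [D 0] on [Z], this eigenspace is stable, and minimality forces it to be
   all of [Z]. *)
pose Z' := (Z :&: eigenspace x a)%MS.
suff : (Z <= Z')%MS by move=> /submx_trans; apply; exact: capmxSr.
rewrite -(mxrank_leqif_sup (capmxSl _ _)) eqn_leq mxrankS ?capmxSl //= rZ.
apply: minZ; apply/asboolP; exists Z' => //; split.
- apply: contraNneq w0 => Z'0; rewrite -submx0 -Z'0 sub_capmx wZ.
  exact/eigenspaceP.
- exact: submx_trans (capmxSl _ _) ZU.
move=> y D0y; rewrite sub_capmx (submx_trans (submxMr _ (capmxSl _ _))) ?Zx //=.
apply/rV_subP => _ /submxP[u ->]; rewrite mulmxA.
have : (u *m Z' <= Z')%MS by rewrite submxMl.
rewrite sub_capmx => /andP[uZ /eigenspaceP ux]; apply/eigenspaceP.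
have := Zcomm _ _ D0y uZ; rewrite mulmxBr => /subr0_eq.
by rewrite -!mulmxE !mulmxA ux => ->; rewrite -scalemxAl.
Qed.

(** * Closed subalgebras and ideals *)

Section Bracket.
Variables (K : numFieldType) (L : banachLieType K).
Implicit Types (a b c x y z : L) (k : K).

HB.instance Definition _ (a : L) :=
  GRing.isLinear.Build K L L *:%R (lieb a) (lieb_linearr a).

Lemma liebDl a b c : lieb (a + b) c = lieb a c + lieb b c.
Proof. by have := lieb_linearl c 1 a b; rewrite !scale1r. Qed.

Lemma liebC a b : lieb a b = - lieb b a.
Proof.
apply/eqP; rewrite -addr_eq0; have := liebxx (a + b).
by rewrite liebDl !linearD /= !liebxx add0r addr0 => ->.
Qed.

Lemma liebDr a b c : lieb a (b + c) = lieb a b + lieb a c.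
Proof. exact: linearD. Qed.

Lemma lieb0l b : lieb 0 b = 0.
Proof. by rewrite liebC linear0 oppr0. Qed.

Lemma liebZl k a b : lieb (k *: a) b = k *: lieb a b.
Proof. by have := lieb_linearl b k a 0; rewrite lieb0l !addr0. Qed.

Lemma lieb_der a b c : lieb a (lieb b c) = lieb (lieb a b) c + lieb b (lieb a c).
Proof.
have := lieb_jacobi a b c.
rewrite (liebC c a) linearN /= (liebC c (lieb a b)) -addrA -opprD => /subr0_eq->.
by rewrite addrC.
Qed.

Lemma lieb_continuous a : continuous (lieb a).
Proof.
have [t t0 ht] := @lieb_bounded K L.
apply/(linear_bounded_continuous (lieb a))/linear_boundedP; near=> r => x.
apply: le_trans (ht a x) _; apply: ler_wpM2r => //.
by near: r; apply: nbhs_pinfty_ge; rewrite ger0_real // mulr_ge0 // ltW.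
Unshelve. all: by end_near. Qed.

Lemma lieb_continuousl b : continuous (lieb^~ b).
Proof.
have -> : lieb^~ b = (fun a => - lieb b a) by apply/funext => a; exact: liebC.
by move=> a; apply: cvgN; exact: lieb_continuous.
Qed.

End Bracket.

Section Subspaces.
Variables (K : numFieldType) (L : banachLieType K).
Implicit Types (a b c v x y z : L) (k : K) (M N A : set L).

Lemma linear_subspaceP M : linear_subspace M <->
  M 0 /\ forall k x y, M x -> M y -> M (k *: x + y).
Proof.
split=> -[]; rewrite ?inE.
  move=> M0 Ml; split=> // k x y Mx My.
  by have := Ml k x y; rewrite !inE; apply.
by move=> M0 Ml; split=> [|k x y]; rewrite ?inE //; exact: Ml.
Qed.

Section Theory.
Variables (M : set L) (linM : linear_subspace M).

Lemma linear_subspace0 : M 0. Proof. by have [] := (linear_subspaceP M).1 linM. Qed.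

Lemma linear_subspaceD x y : M x -> M y -> M (x + y).
Proof.
have [_ Ml] := (linear_subspaceP M).1 linM.
by move=> Mx My; rewrite -[x]scale1r; exact: Ml.
Qed.

Lemma linear_subspaceZ k x : M x -> M (k *: x).
Proof.
have [M0 Ml] := (linear_subspaceP M).1 linM.
by move=> Mx; rewrite -[_ *: _]addr0; exact: Ml.
Qed.

Lemma linear_subspaceN x : M x -> M (- x).
Proof. by rewrite -scaleN1r; exact: linear_subspaceZ. Qed.

Lemma linear_subspaceB x y : M x -> M y -> M (x - y).
Proof. by move=> Mx My; apply: linear_subspaceD => //; exact: linear_subspaceN. Qed.

End Theory.

(** The preimage of [M] is a closed set containing [A]. Conditions on dense subspaces are extended
    below in this way. *)
Lemma continuous_closure (f : L -> L) A M : continuous f -> closed M ->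
  (forall x, A x -> M (f x)) -> forall x, closure A x -> M (f x).
Proof.
move=> cf cM AM x; rewrite closureE => /(_ (f @^-1` M)); apply.
by split=> //; apply: preimage_closed => // y _; exact: cf.
Qed.

Lemma closure_linear_subspace M : linear_subspace M -> linear_subspace (closure M).
Proof.
move=> linM; apply/linear_subspaceP; split.
  by apply: subset_closure; exact: linear_subspace0.
have cl := @closed_closure _ M.
move=> k x y clx cly.
apply: (@continuous_closure (fun x => k *: x + y) M) clx => // [z|{}x Mx].
  by apply: cvgD; [exact: scaler_continuous|exact: cvg_cst].
apply: (@continuous_closure (fun y => k *: x + y) M) cly => // [z|{}y My].
  by apply: cvgD; [exact: cvg_cst|exact: cvg_id].
apply: subset_closure; apply: linear_subspaceD => //.
exact: linear_subspaceZ.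
Qed.

(** The two arguments are passed to the closure one after the other, so separate continuity
    suffices. *)
Lemma closure_bracket M N : closed N -> (forall a b, M a -> M b -> N (lieb a b)) ->
  forall a b, closure M a -> closure M b -> N (lieb a b).
Proof.
move=> cN MN a b cla clb.
apply: (continuous_closure (@lieb_continuousl _ _ b) cN) cla => {}a Ma.
by apply: (continuous_closure (@lieb_continuous _ _ a) cN) clb => {}b; exact: MN.
Qed.

Lemma closure_lie_subalgebra M : lie_subalgebra M -> lie_subalgebra (closure M).
Proof.
move=> [linM MM]; split; first exact: closure_linear_subspace.
apply: closure_bracket; first exact: closed_closure.
by move=> a b Ma Mb; apply: subset_closure; exact: MM.
Qed.

Lemma closure_lie_ideal M : lie_ideal M -> lie_ideal (closure M).
Proof.
move=> [linM MM]; split; first exact: closure_linear_subspace.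
move=> a; apply: (continuous_closure (@lieb_continuous _ _ a)) => [|b Mb].
  exact: closed_closure.
by apply: subset_closure; exact: MM.
Qed.

Definition sum_set M N : set L := [set x + y | x in M & y in N].

Lemma sum_setl M N : linear_subspace N -> M `<=` sum_set M N.
Proof.
by move=> lN x Mx; exists x => //; exists 0; rewrite ?addr0 //; exact: linear_subspace0.
Qed.

Lemma sum_setr M N : linear_subspace M -> N `<=` sum_set M N.
Proof.
by move=> lM x Nx; exists 0; [exact: linear_subspace0|exists x; rewrite ?add0r].
Qed.

Lemma sum_linear_subspace M N : linear_subspace M -> linear_subspace N ->
  linear_subspace (sum_set M N).
Proof.
move=> lM lN; apply/linear_subspaceP; split.
  by apply: sum_setl => //; exact: linear_subspace0.
move=> k _ _ [x Mx [y Ny <-]] [x' Mx' [y' Ny' <-]].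
exists (k *: x + x'); first by apply: linear_subspaceD => //; exact: linear_subspaceZ.
exists (k *: y + y'); first by apply: linear_subspaceD => //; exact: linear_subspaceZ.
by rewrite scalerDr addrACA.
Qed.

Lemma sum_subalgebra_ideal M N : lie_subalgebra M -> lie_ideal N ->
  lie_subalgebra (sum_set M N).
Proof.
move=> [lM MM] [lN NN]; split; first exact: sum_linear_subspace.
move=> _ _ [x Mx [y Ny <-]] [x' Mx' [y' Ny' <-]].
exists (lieb x x'); first exact: MM.
exists (lieb x y' + lieb y (x' + y')).
  apply: linear_subspaceD => //; first exact: NN.
  by rewrite liebC; apply: linear_subspaceN => //; exact: NN.
by rewrite liebDl addrA -liebDr.
Qed.

Lemma sum_lie_ideal M N : lie_ideal M -> lie_ideal N -> lie_ideal (sum_set M N).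
Proof.
move=> [lM MM] [lN NN]; split; first exact: sum_linear_subspace.
move=> a _ [x Mx [y Ny <-]]; exists (lieb a x); first exact: MM.
by exists (lieb a y); [exact: NN|rewrite liebDr].
Qed.

Lemma closed_span_subspace A : linear_subspace (closed_span A).
Proof.
apply: closure_linear_subspace; apply/linear_subspaceP; split.
  by move=> N [lN _]; exact: linear_subspace0.
move=> k x y Ax Ay N [lN AN]; apply: linear_subspaceD => //.
  by apply: linear_subspaceZ => //; apply: Ax.
by apply: Ay.
Qed.

Lemma sub_closed_span A : A `<=` closed_span A.
Proof. by move=> x Ax; apply: subset_closure; exact: sub_gen_smallest. Qed.

Lemma closed_span_sub A M : linear_subspace M -> closed M -> A `<=` M ->
  closed_span A `<=` M.
Proof.
move=> lM cM AM; rewrite [M in _ `<=` M](closure_id M).1 //.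
by apply: closureS; exact: smallest_sub.
Qed.

Lemma closed_bracket_sub A B M : linear_subspace M -> closed M ->
  (forall a b, A a -> B b -> M (lieb a b)) -> closed_bracket A B `<=` M.
Proof.
move=> lM cM ABM; apply: closed_span_sub => // _ [a Aa [b Bb <-]].
exact: ABM.
Qed.

Lemma lieb_closed_bracket A B a b : A a -> B b -> closed_bracket A B (lieb a b).
Proof. by move=> Aa Bb; apply: sub_closed_span; exists a => //; exists b. Qed.

(** The elements sent into the closed bracket by [lieb a] form a closed subspace, and it contains
    the generators because [lieb a] is a derivation. *)
Lemma closed_bracket_ideal A B : lie_ideal A -> lie_ideal B ->
  lie_ideal (closed_bracket A B).
Proof.
move=> [lA AA] [lB BB]; have lAB : linear_subspace (closed_bracket A B).
  exact: closed_span_subspace.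
split=> // a.
change (closed_bracket A B `<=` lieb a @^-1` closed_bracket A B).
apply: closed_bracket_sub.
- apply/linear_subspaceP; split=> [|k x y Mx My].
    by rewrite /preimage/= linear0; exact: (linear_subspace0 lAB).
  rewrite /preimage/= linearP.
  apply: (linear_subspaceD lAB) => //.
  exact: (linear_subspaceZ lAB).
- apply: preimage_closed; last exact: closed_closure.
  by move=> x _; exact: lieb_continuous.
move=> x y Ax By; rewrite /preimage/= lieb_der; apply: (linear_subspaceD lAB) => //.
  by apply: lieb_closed_bracket => //; exact: AA.
by apply: lieb_closed_bracket => //; exact: BB.
Qed.

Lemma lie_idealT : lie_ideal [set: L].
Proof. by split=> //; apply/linear_subspaceP. Qed.

Lemma derived_lie_ideal n : lie_ideal (derived_lie L n).
Proof. by elim: n => [|n IH] /=; [exact: lie_idealT|exact: closed_bracket_ideal]. Qed.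

Lemma lower_central_ideal n : lie_ideal (lower_central L n).
Proof.
elim: n => [|n IH] /=; first exact: lie_idealT.
by apply: closed_bracket_ideal => //; exact: lie_idealT.
Qed.

Lemma derived_lie_closed n : closed (derived_lie L n).
Proof. by case: n => [|n]; [exact: closedT|exact: closed_closure]. Qed.

Lemma derived_lieS n : derived_lie L n.+1 `<=` derived_lie L n.
Proof.
have [lI II] := derived_lie_ideal n.
by apply: closed_bracket_sub => //; [exact: derived_lie_closed|move=> a b _; exact: II].
Qed.

Lemma derived_lie_anti m n : (m <= n)%N -> derived_lie L n `<=` derived_lie L m.
Proof.
elim: n => [|n IH]; first by rewrite leqn0 => /eqP->.
rewrite leq_eqVlt => /orP[/eqP->//|/IH]; apply: subset_trans.
exact: derived_lieS.
Qed.

Lemma last_not_sub (S : nat -> set L) n M : linear_subspace M -> M != setT ->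
  S 0%N = setT -> S n = [set 0] -> exists i, ~ (S i `<=` M) /\ S i.+1 `<=` M.
Proof.
move=> lM MT S0 Sn.
have SnM : S n `<=` M by rewrite Sn => _ ->; exact: linear_subspace0.
elim: n SnM {Sn} => [|n IH] SnM.
  by case/eqP: MT; rewrite -subTset -S0.
by have [/IH//|nS] := pselect (S n `<=` M); exists n.
Qed.

(** A ball around [v] misses [M], and scaling by [k] spreads this along the line of [v]. Later this
    turns a norm estimate modulo [M] into a bound on an eigenvalue. *)
Lemma closed_subspace_dist M v : linear_subspace M -> closed M -> ~ M v ->
  exists2 r, 0 < r & forall k x, M x -> r * `|k| <= `|k *: v - x|.
Proof.
move=> lM cM nMv.
have /nbhs_ballP[r /= r0 rM] : nbhs v (~` M).
  by apply: open_nbhs_nbhs; split=> //; exact: closed_openC.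
exists r => // k x Mx; have [->|k0] := eqVneq k 0; first by rewrite normr0 mulr0.
rewrite -[x](scalerKV k0) -scalerBr normrZ mulrC ler_pM2l ?normr_gt0 //.
rewrite real_leNgt ?ger0_real ?(ltW r0) //; apply/negP => lt.
have := rM (k^-1 *: x); rewrite /= -ball_normE /=; apply => //.
exact: linear_subspaceZ.
Qed.

(** A proper [closure N] would equal [M] by maximality, but it contains [x]. *)
Lemma maximal_dense (F : set (set L)) M N x : maximal_in (proper_closed F) M ->
  F (closure N) -> M `<=` N -> N x -> ~ M x -> closure N = setT.
Proof.
move=> [_ maxM] FN MN Nx nMx; apply/eqP; apply: contra_notT nMx => clT.
rewrite -(maxM (closure N)); first exact: subset_closure.
  by split=> //; exact: closed_closure.
exact: subset_trans MN (@subset_closure _ _).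
Qed.

End Subspaces.

(** * Maximal closed subalgebras *)

(* A spanning family modulo [M] of least size is a basis of [L / M]. *)
Lemma linear_coordinates (K : numFieldType) (L : banachLieType K) (M : set L) :
  linear_subspace M -> finite_codim M ->
  exists n (phi : {linear L -> 'rV[K]_n}) (psi : {linear 'rV[K]_n -> L}),
    cancel psi phi /\ forall x, phi x = 0 <-> M x.
Proof.
move=> lM codimM.
pose P n := `[< exists e : 'I_n -> L,
  forall x, exists c : 'I_n -> K, M (x - \sum_i c i *: e i) >].
have exP : exists n, P n by have [n he] := codimM; exists n; apply/asboolP.
case: (ex_minnP exP) => n /asboolP[e he] minn.
have free c : M (\sum_i c i *: e i) -> forall j, c j = 0.
  move=> Mc j; apply/eqP; apply: contraT => cj0.
  case: n => [|n] in e he minn c Mc j cj0 *; first by case: j {cj0}.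
  suff /minn : P n by rewrite ltnn.
  apply/asboolP; exists (e \o lift j) => x; have [d Md] := he x.
  (* Adding [d j / c j] times the relation [c] cancels [e j], so the other vectors already span
     modulo [M]. *)
  exists (fun i => d (lift j i) - d j / c j * c (lift j i)).
  have := linear_subspaceD lM Md (linear_subspaceZ lM (d j / c j) Mc).
  rewrite (bigD1_ord j) //= [in X in _ + X](bigD1_ord j) //=.
  rewrite scalerDr scalerA divfK // scaler_sumr => MM.
  apply: (eq_ind _ M MM); under [in RHS]eq_bigr do rewrite scalerBl -scalerA.
  rewrite sumrB /= (addrC (d j *: e j)) opprD addrA addrA subrK.
  by rewrite opprB addrA addrAC.
have [c hc] := choice he.
pose psi (w : 'rV[K]_n) := \sum_i w 0 i *: e i.
pose phi x := \row_i c x i.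
have lpsi : linear psi.
  move=> k u w; rewrite /psi scaler_sumr -big_split; apply: eq_bigr => i _.
  by rewrite !mxE scalerDl scalerA.
(* The coordinates come from a choice; their uniqueness modulo [M] is what makes [phi] linear. *)
have uniq x w : M (x - psi w) -> phi x = w.
  move=> Mw; apply/rowP => i; rewrite mxE; apply/eqP; rewrite -subr_eq0.
  apply/eqP; apply: (free (fun i => c x i - w 0 i)).
  have := linear_subspaceB lM Mw (hc x); rewrite opprB addrC subrKA.
  by under [in X in _ -> X]eq_bigr do rewrite scalerBl; rewrite sumrB.
have hphi x : M (x - psi (phi x)).
  rewrite /psi; under eq_bigr do rewrite mxE; exact: hc.
have lphi : linear phi.
  move=> k x y; apply: uniq; rewrite lpsi opprD addrACA -scalerBr.
  by apply: linear_subspaceD => //; exact: linear_subspaceZ.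
pose Phi : {linear L -> 'rV[K]_n} :=
  HB.pack phi (GRing.isLinear.Build K L 'rV[K]_n *:%R phi lphi).
pose Psi : {linear 'rV[K]_n -> L} :=
  HB.pack psi (GRing.isLinear.Build K 'rV[K]_n L *:%R psi lpsi).
have psi0 : psi 0 = 0 := linear0 Psi.
exists n, Phi, Psi; split=> [w|x].
  by apply: uniq; rewrite subrr; exact: linear_subspace0.
split=> [|Mx]; first by move=> p0; have := hphi x; rewrite [phi x]p0 psi0 subr0.
by apply: uniq; rewrite psi0 subr0.
Qed.

(** Lie's theorem is applied to the matrices of [M] acting on [L / M], filtered by the intersections
    of [M] with the derived series. *)
Lemma lie_eigenvector (K : numClosedFieldType) (L : banachLieType K) (M : set L) :
  solvable_lie L -> lie_subalgebra M -> finite_codim M -> M != setT ->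
  exists2 v, ~ M v & forall a, M a -> exists c, M (lieb a v - c *: v).
Proof.
move=> [N derN] [lM MM] codimM MT.
have [n [phi [psi [psiK phi0]]]] := linear_coordinates lM codimM.
case: n => [|m] in phi psi psiK phi0.
  by case/eqP: MT; apply/seteqP; split=> // x _; apply/phi0; exact: thinmx0.
pose rho a := lin1_mx (phi \o lieb a \o psi).
have rhoE a w : w *m rho a = phi (lieb a (psi w)) by rewrite mul_rV_lin1.
have phi_rho a x : M a -> phi (lieb a x) = phi x *m rho a.
  move=> Ma; apply/eqP; rewrite -subr_eq0 rhoE -!linearB /=; apply/eqP/phi0.
  by apply: MM => //; apply/phi0; rewrite linearB /= psiK subrr.
pose D i := [set rho a | a in M `&` derived_lie L i].
have [i x y|i x|x|w w0 wD] := @lie_theorem K m N D.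
(* Matrices act on row vectors from the right, which reverses products; hence [lieb b a] and not
   [lieb a b]. *)
- move=> [a [Ma Da] <-] [b [Mb Db] <-]; exists (lieb b a).
    by split; [exact: MM|exact: lieb_closed_bracket].
  apply/row_matrixP => j; rewrite !rowE mulmxBr -!mulmxE !mulmxA.
  by rewrite !(rhoE _ (delta_mx 0 j)) -!phi_rho // -linearB lieb_der addrK.
- by move=> [a [Ma /derived_lieS Da] <-]; exists a.
- move=> [a [_]]; rewrite derN => -> <-; apply/row_matrixP => j.
  by rewrite rowE rhoE lieb0l linear0 row0.
exists (psi w) => [/phi0|a Ma]; first by rewrite psiK => w00; rewrite w00 eqxx in w0.
have [c wc] := wD _ (ex_intro2 _ _ a (conj Ma I) erefl).
by exists c; apply/phi0; rewrite linearB linearZ /= phi_rho // psiK wc subrr.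
Qed.

Section Main.
Variables (K : numClosedFieldType) (L : banachLieType K).
Implicit Types (a b x y v : L) (M N : set L).

Lemma brackets_sub_dense M N : closed M -> closure N = setT ->
  (forall a b, N a -> N b -> M (lieb a b)) -> forall a b, M (lieb a b).
Proof.
by move=> cM clN NM a b; apply: (closure_bracket cM NM); rewrite clN.
Qed.

(** In [[M + S_k, M + S_k]] the terms with a factor in [M] stay in the ideal [M], and [[S_k, S_k]]
    lies in [S_(k+1)]. *)
Lemma maximal_ideal_brackets M : solvable_lie L ->
  maximal_in (proper_closed (@lie_ideal K L)) M -> forall a b, M (lieb a b).
Proof.
move=> [n Ln] maxM; have [[idM cM MT] _] := maxM; have [lM MM] := idM.
have [k [/existsNP[x /not_implyP[kx nMx]] k1M]] := last_not_sub lM MT erefl Ln.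
have idk := derived_lie_ideal L k; have [lk _] := idk.
have dense := maximal_dense maxM (closure_lie_ideal (sum_lie_ideal idM idk))
  (sum_setl lk) (sum_setr lM kx) nMx.
apply: brackets_sub_dense cM dense _ => _ _ [a Ma [b kb <-]] [a' Ma' [b' kb' <-]].
rewrite liebDr !liebDl; apply: linear_subspaceD => //; last first.
  apply: linear_subspaceD => //; last by apply: k1M; exact: lieb_closed_bracket.
  by rewrite liebC; apply: linear_subspaceN => //; exact: MM.
by apply: linear_subspaceD => //; exact: MM.
Qed.

(** As [M] is only a subalgebra here, the mixed terms are controlled by the series: [[L, S_k]] lies
    in [S_(k+1)], hence in [M]. *)
Lemma maximal_subalgebra_nilpotent M : nilpotent_lie L ->
  maximal_in (proper_closed (@lie_subalgebra K L)) M -> forall a b, M (lieb a b).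
Proof.
move=> [n Ln] maxM; have [[subM cM MT] _] := maxM; have [lM MM] := subM.
have [k [/existsNP[x /not_implyP[kx nMx]] k1M]] := last_not_sub lM MT erefl Ln.
have idk := lower_central_ideal L k; have [lk _] := idk.
have dense := maximal_dense maxM
  (closure_lie_subalgebra (sum_subalgebra_ideal subM idk))
  (sum_setl lk) (sum_setr lM kx) nMx.
have kM a b : lower_central L k b -> M (lieb a b).
  by move=> kb; apply: k1M; exact: lieb_closed_bracket.
apply: brackets_sub_dense cM dense _ => _ _ [a Ma [b kb <-]] [a' Ma' [b' kb' <-]].
rewrite liebDr !liebDl; apply: linear_subspaceD => //; last first.
  by apply: linear_subspaceD => //; exact: kM.
apply: linear_subspaceD => //; first exact: MM.
by rewrite liebC; apply: linear_subspaceN => //; exact: kM.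
Qed.

Definition line v : set L := range (fun c => c *: v).

Lemma line_subspace v : linear_subspace (line v).
Proof.
apply/linear_subspaceP; split; first by exists 0; rewrite ?scale0r.
by move=> k _ _ [c _ <-] [d _ <-]; exists (k * c + d); rewrite // scalerDl scalerA.
Qed.

Lemma mem_line v : line v v. Proof. by exists 1; rewrite ?scale1r. Qed.

Section MaximalSubalgebra.
Variable M : set L.
Hypothesis maxM : maximal_in (proper_closed (@lie_subalgebra K L)) M.

(** The eigenvector relation and [[v, v] = 0] make [M + K v] a subalgebra strictly larger than
    [M]. *)
Lemma dense_add_eigenvector v : ~ M v ->
  (forall a, M a -> exists c, M (lieb a v - c *: v)) ->
  closure (sum_set M (line v)) = setT.
Proof.
have [[[lM MM] _ _] _] := maxM => nMv Mv.
apply: (maximal_dense maxM) (sum_setl (line_subspace v))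
  (sum_setr lM (mem_line v)) nMv.
apply: closure_lie_subalgebra; split.
  exact: sum_linear_subspace lM (line_subspace v).
have Nlie a d : M a -> sum_set M (line v) (d *: lieb a v).
  move=> /Mv[c Mc]; exists (d *: (lieb a v - c *: v)).
    exact: linear_subspaceZ.
  by exists ((d * c) *: v); [exists (d * c)|rewrite -scalerA -scalerDr subrK].
have lN := sum_linear_subspace lM (line_subspace v).
move=> _ _ [a Ma [_ [c _ <-] <-]] [b Mb [_ [d _ <-] <-]].
rewrite liebDr !liebDl; apply: (linear_subspaceD lN).
  apply: (linear_subspaceD lN).
    by apply: sum_setl (MM _ _ Ma Mb); exact: line_subspace.
  by rewrite liebZl liebC scalerN -scaleNr; exact: Nlie.
rewrite liebZl linearZ [lieb v _]linearZ /= liebxx !scaler0 addr0; exact: Nlie.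
Qed.

(* The eigenvalue relation is a closed condition on [x], and it holds on the
   dense subspace spanned by [M] and one common eigenvector. *)
Lemma maximal_subalgebra_weight : solvable_lie L -> finite_codim M ->
  forall a, M a -> exists c, forall x, M (lieb a x - c *: x).
Proof.
have [[subM cM MT] _] := maxM; have [lM MM] := subM => solL codimM a Ma.
have [v nMv Mv] := lie_eigenvector solL subM codimM MT.
have [c Mc] := Mv a Ma; exists c => x.
have : closure (sum_set M (line v)) x by rewrite dense_add_eigenvector.
apply: (@continuous_closure _ _ (fun x => lieb a x - c *: x)) => // [z|].
  by apply: cvgB; [exact: lieb_continuous|exact: scaler_continuous].
move=> _ [b Mb [_ [d _ <-] <-]].
rewrite liebDr scalerDr opprD addrACA; apply: linear_subspaceD => //.
  by apply: linear_subspaceB => //; [exact: MM|exact: linear_subspaceZ].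
rewrite [lieb a (d *: v)]linearZ /= scalerA mulrC -scalerA -scalerBr.
exact: linear_subspaceZ.
Qed.

End MaximalSubalgebra.

Lemma maximal_subalgebra_derived2 M : solvable_lie L ->
  maximal_in (proper_closed (@lie_subalgebra K L)) M -> finite_codim M ->
  derived_lie L 2 `<=` M.
Proof.
move=> solL maxM codimM; have [[subM cM MT] _] := maxM; have [lM MM] := subM.
have [n Ln] := solL.
have [k [kM k1M]] := last_not_sub lM MT erefl Ln.
case: k kM k1M => [_|[_|k]].
- by apply: subset_trans; exact: derived_lieS.
- by [].
(* The last index is now [k.+2], and the goal becomes the inclusion that [nkM] denies. *)
move=> nkM k1M; case: (nkM) => /=.
move/existsNP: nkM => [v /not_implyP[kv nMv]].
have [lk kk] := derived_lie_ideal L k.+2.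
have weight := maximal_subalgebra_weight maxM solL codimM.
have dense : closure (sum_set M (line v)) = setT.
  apply: dense_add_eigenvector => // a /weight[c Mc]; by exists c.
have vkM x : derived_lie L k.+2 x -> M (lieb x v).
  by move=> kx; apply: k1M; exact: lieb_closed_bracket.
(* The condition on [x] is closed and linear, so brackets of elements of [M + K v] suffice. Terms
   involving [v] lie in the ideal [S_(k+2)], where [vkM] applies. *)
have D1M : derived_lie L 1 `<=` [set x | M (lieb x v)].
  have cE : closed [set x | M (lieb x v)].
    by apply: (@preimage_closed _ _ (lieb^~ v)) => // x _; exact: lieb_continuousl.
  have lE : linear_subspace [set x | M (lieb x v)].
    apply/linear_subspaceP; split=> /= [|c x y Mx My].
      by rewrite lieb0l; exact: linear_subspace0.
    rewrite liebDl liebZl; apply: linear_subspaceD => //; exact: linear_subspaceZ.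
  apply: closed_bracket_sub => // a b _ _.
  apply: brackets_sub_dense cE dense _ a b.
  move=> _ _ [a Ma [_ [c _ <-] <-]] [b Mb [_ [d _ <-] <-]].
  rewrite liebDr !liebDl addrAC -addrA; apply: (linear_subspaceD lE); last first.
    apply: vkM; rewrite -(liebDl a) liebZl; apply: (linear_subspaceD lk).
      by apply: kk; exact: (linear_subspaceZ lk).
    apply: (linear_subspaceZ lk); rewrite liebC; apply: (linear_subspaceN lk).
    exact: kk.
  have [ca hca] := weight a Ma; have [cb hcb] := weight b Mb.
  change (M (lieb (lieb a b) v)).
  (* Modulo [M], [a] and [b] act by the commuting scalars [ca] and [cb], so [lieb a b] acts by 0;
     each group on the right is in [M]. *)
  have -> : lieb (lieb a b) v =
      (lieb a (lieb b v) - ca *: lieb b v) - (lieb b (lieb a v) - cb *: lieb a v)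
      + (ca *: (lieb b v - cb *: v) - cb *: (lieb a v - ca *: v)).
    rewrite (lieb_der a b v) !scalerBr !scalerA (mulrC cb).
    rewrite (opprB (cb *: lieb a v)) subrKA opprB -addrA.
    by rewrite [X in _ = _ + X]addrC !subrKA addrK.
  apply: linear_subspaceD => //; apply: linear_subspaceB => //.
    by apply: linear_subspaceZ => //; exact: hcb.
  by apply: linear_subspaceZ => //; exact: hca.
have [r r0 hr] := closed_subspace_dist lM cM nMv.
have [t t0 ht] := @lieb_bounded K L.
apply: closed_bracket_sub => // x y kx ky.
have sub1 := @derived_lie_anti _ L 1 k.+1 isT.
have xv := D1M _ (sub1 _ kx); have yv := D1M _ (sub1 _ ky).
rewrite [M](closure_id M).1 // => U /nbhs_ballP[e /= e0 eU].
(* [C] times the norm of [d] will bound [lieb d y + l *: y], one summand for each term; [1 + C]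
   keeps the divisor positive. *)
pose C := t * `|y| + t * `|v| / r * `|y|.
have C0 : 0 <= C by rewrite addr_ge0 ?mulr_ge0 ?invr_ge0 ?(ltW t0) ?(ltW r0).
have d0 : 0 < e / (1 + C) by rewrite divr_gt0 // ltr_wpDr.
(* With [d := x - (m + c *: v)] small, [lieb m] acts on [L / M] by a scalar [l],
   and [lieb x v] in [M] forces [l] to be of the order of [d]. *)
have clx : closure (sum_set M (line v)) x by rewrite dense.
have [_ [[m Mm [_ [c _ <-] <-]]]] := clx _ (nbhsx_ballx x _ d0).
rewrite -ball_normE /=; set d := x - _ => dlt.
have exyz z : lieb x z = lieb d z + (lieb m z + c *: lieb v z).
  by rewrite -liebZl -!liebDl subrK.
have [l hl] := weight m Mm.
(* Removing the small error leaves [lieb m y - l *: y] plus [c *: lieb v y], both in [M]. *)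
exists (lieb x y - (lieb d y + l *: y)); split.
  have -> : lieb x y - (lieb d y + l *: y) = (lieb m y - l *: y) + c *: lieb v y.
    by rewrite exyz opprD addrACA subrr add0r addrAC.
  apply: linear_subspaceD => //; apply: linear_subspaceZ => //.
  by rewrite liebC; exact: linear_subspaceN.
apply: eU; rewrite -ball_normE /= opprB addrC subrK.
have ldv : r * `|l| <= t * `|d| * `|v|.
  apply: le_trans (ht d v); rewrite -normrN.
  have -> : - lieb d v = l *: v - (lieb x v - (lieb m v - l *: v)).
    rewrite exyz liebxx scaler0 addr0 opprB.
    by rewrite addrA [l *: v + _]addrC subrK opprD addrCA subrr addr0.
  by apply: hr; exact: linear_subspaceB.
apply: le_lt_trans (ler_normD _ _) _; rewrite normrZ.
apply: (@le_lt_trans _ _ (`|d| * C)).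
  rewrite mulrDr; apply: lerD.
    by apply: le_trans (ht d y) _; rewrite mulrCA mulrA.
  rewrite mulrA ler_wpM2r // -(ler_pM2l r0) (le_trans ldv) //.
  suff -> : r * (`|d| * (t * `|v| / r)) = t * `|d| * `|v| by [].
  by field; rewrite gt_eqF.
apply: (@le_lt_trans _ _ (`|d| * (1 + C))); first by rewrite ler_wpM2l // ler_wpDl.
by rewrite -ltr_pdivlMr // ltr_wpDr.
Qed.

End Main.

Theorem theorem9p10 (R : realType) (L : banachLieType R[i]) :
  [/\ Sem_Smax L -> solvable_lie L -> derived_lie L 2 = [set 0],
      Sem_Smax L -> (nilpotent_lie L <-> commutative_lie L)
    & Sem_Jmax L -> solvable_lie L -> commutative_lie L].
Proof.
split=> [SL solL|SL|JL solL a b].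
- apply/seteqP; split=> [x dx|_ ->].
    by rewrite -SL => M [maxM codimM]; exact: maximal_subalgebra_derived2 dx.
  by have [+ _] := derived_lie_ideal L 2; exact: linear_subspace0.
- split=> [nilL a b|comL].
    have : [set 0] (lieb a b); last by [].
    by rewrite -SL => M [maxM _]; exact: maximal_subalgebra_nilpotent.
  exists 1%N; apply/seteqP; split=> [|_ ->]; last first.
    by have [+ _] := lower_central_ideal L 1; exact: linear_subspace0.
  apply: closed_bracket_sub => [||a b _ _]; last exact: comL.
    by apply/linear_subspaceP; split=> // k _ _ -> ->; rewrite scaler0 addr0.
  (* [[set 0]] is closed as an intersection of closed subalgebras. *)
  by rewrite -SL; apply: closed_bigI => M [[[_ cM _] _] _].
have : [set 0] (lieb a b); last by [].
by rewrite -JL => M [maxM _]; exact: maximal_ideal_brackets.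
Qed.
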